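(* Let $F$ be a field with a nontrivial valuation $v$ and valuation domain $O_v$. Let $R$ be a torsion-free algebra over $O_v$ such that $[R\otimes_{O_v}F:F]<\infty$. Then $R$ satisfies INC (incomparability) over $O_v$; that is, whenever $Q_1\subset Q_2$ (proper inclusion) in $\operatorname{Spec}(R)$, one has $Q_1\cap O_v\subset Q_2\cap O_v$ (proper inclusion).
   Context: $O_v=\{x\in F: v(x)\ge0\}$. Rings are associative with $1$, not necessarily commutative; $\operatorname{Spec}(R)$ is the set of prime (two-sided) ideals. An $O_v$-algebra is a ring $R$ with a unitary ring homomorphism $O_v\to Z(R)$, $c\mapsto c\cdot 1_R$; it is torsion-free if $cr=0$ with $c\in O_v$, $r\in R$ implies $c=0$ or $r=0$. For $I\subseteq R$, $I\cap O_v=\{c\in O_v: c\cdot 1_R\in I\}$. $[V:F]$ denotes the dimension of $V$ over $F$. *)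

(* Defs.v *)
From HB Require Import structures.
From mathcomp Require Import all_boot all_order all_algebra.
From mathcomp Require Import generic_quotient.
From mathcomp Require Import boolp classical_sets.

Set Implicit Arguments.
Unset Strict Implicit.
Unset Printing Implicit Defensive.

Import Order.TTheory GRing.Theory Num.Theory.
Local Open Scope ring_scope.
Local Open Scope classical_set_scope.
Local Open Scope quotient_scope.

HB.mixin Record POrderedZmodule_isTotalGroup G of Num.POrderedZmodule G := {
  ordered_le_total : total (<=%R : rel G);
  ordered_leD2l : forall z x y : G, x <= y -> z + x <= z + y
}.

#[short(type="orderedZmodType")]
HB.structure Definition OrderedZmodule :=
  { G of Num.POrderedZmodule G & POrderedZmodule_isTotalGroup G }.

(* [option G] is G together with a largest absorbing element, [None]. *)
Section ExtendedGroup.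
Variable G : orderedZmodType.

Definition ext_add (a b : option G) : option G :=
  match a, b with
  | Some x, Some y => Some (x + y)
  | _, _ => None
  end.

Definition ext_le (a b : option G) : bool :=
  match a, b with
  | _, None => true
  | None, Some _ => false
  | Some x, Some y => x <= y
  end.

Definition ext_min (a b : option G) : option G := if ext_le a b then a else b.

End ExtendedGroup.

Record valuation (F : fieldType) (G : orderedZmodType) := Valuation {
  val_fun :> F -> option G;
  val_top : forall x, val_fun x = None <-> x = 0;
  val_mul : forall x y, val_fun (x * y) = ext_add (val_fun x) (val_fun y);
  val_add : forall x y,
    ext_le (ext_min (val_fun x) (val_fun y)) (val_fun (x + y))
}.

Definition nontrivial_valuation (F : fieldType) (G : orderedZmodType)
  (v : valuation F G) : Prop := exists x : F, x <> 0 /\ v x <> Some 0.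

Definition valuation_domain_pred (F : fieldType) (G : orderedZmodType)
  (v : valuation F G) : pred F := fun x => ext_le (Some 0) (v x).

Section ValuationDomain.
Variables (F : fieldType) (G : orderedZmodType) (v : valuation F G).

Lemma val_one : v 1 = Some 0.
Proof.
have := val_mul v 1 1; rewrite mulr1.
case E: (v 1) => [g|] /=; last first.
  by move/(val_top v): E => /eqP; rewrite oner_eq0.
by case=> /eqP; rewrite -[X in X == _]addr0 (inj_eq (addrI g)) => /eqP <-.
Qed.

Lemma val_minus_one : v (-1) = Some 0.
Proof.
have := val_mul v (-1) (-1); rewrite mulrNN mulr1 val_one.
case: (v (-1)) => [g|] //= [] gg0; congr Some.
have /orP[le|le] := ordered_le_total g 0; apply: le_anti; apply/andP; split=> //.
- by have := ordered_leD2l g _ _ le; rewrite -gg0 addr0.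
- by have := ordered_leD2l g _ _ le; rewrite -gg0 addr0.
Qed.

Lemma valuation_domain_closed : subring_closed (valuation_domain_pred v).
Proof.
have addP x y : valuation_domain_pred v x -> valuation_domain_pred v y ->
    valuation_domain_pred v (x + y).
  rewrite /valuation_domain_pred => hx hy.
  have := val_add v x y; rewrite /ext_min.
  case: ifP => _; case: (v (x + y)) => [c|] //.
    by move: hx; case: (v x) => [a|] //=; exact: le_trans.
  by move: hy; case: (v y) => [a|] //=; exact: le_trans.
have mulP x y : valuation_domain_pred v x -> valuation_domain_pred v y ->
    valuation_domain_pred v (x * y).
  rewrite /valuation_domain_pred val_mul.
  case: (v x) (v y) => [a|] [b|] //= ha hb.
  apply: le_trans ha _; rewrite -{1}[a]addr0.
  exact: ordered_leD2l.
split=> [|x y hx hy|x y]; last exact: mulP.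
- by rewrite unfold_in /valuation_domain_pred val_one /=.
- apply: addP => //; rewrite -mulN1r; apply: mulP => //.
  by rewrite /valuation_domain_pred val_minus_one /=.
Qed.

HB.instance Definition _ :=
  GRing.isSubringClosed.Build F (valuation_domain_pred v)
    valuation_domain_closed.

Record valuation_domain := ValuationDomain {
  vd_val :> F;
  vd_valP : vd_val \in valuation_domain_pred v
}.

HB.instance Definition _ := [isSub for vd_val].
HB.instance Definition _ := [Choice of valuation_domain by <:].
HB.instance Definition _ :=
  [SubChoice_isSubComNzRing of valuation_domain by <:].

Definition vd_incl : valuation_domain -> F := val.
HB.instance Definition _ := GRing.RMorphism.on vd_incl.

End ValuationDomain.

Arguments vd_incl {F G} v _.

(* The abelian group underlying S, with A acting through f. *)
Definition restr_scalars (A S : pzRingType) (f : {rmorphism A -> S}) : Type := S.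

Section RestrictionOfScalars.
Variables (A S : pzRingType) (f : {rmorphism A -> S}).

HB.instance Definition _ := GRing.Zmodule.on (restr_scalars f).

Definition restr_scale (a : A) (x : restr_scalars f) : restr_scalars f :=
  f a * (x : S).

Fact restr_scaleA a b x :
  restr_scale a (restr_scale b x) = restr_scale (a * b) x.
Proof. by rewrite /restr_scale rmorphM mulrA. Qed.
Fact restr_scale1 : left_id 1 restr_scale.
Proof. by move=> x; rewrite /restr_scale rmorph1 mul1r. Qed.
Fact restr_scaleDr : right_distributive restr_scale +%R.
Proof. by move=> a x y; rewrite /restr_scale mulrDr. Qed.
Fact restr_scaleDl x : {morph restr_scale^~ x : a b / a + b}.
Proof. by move=> a b; rewrite /restr_scale rmorphD mulrDl. Qed.

HB.instance Definition _ :=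
  GRing.Zmodule_isLmodule.Build A (restr_scalars f)
    restr_scaleA restr_scale1 restr_scaleDr restr_scaleDl.

End RestrictionOfScalars.

Section ExtensionOfScalars.
Variables (A K : comPzRingType) (g : {rmorphism A -> K}) (M : lmodType A).

(* The list [:: (x1, c1); ...; (xn, cn)] stands for the sum of the
   xi (x) ci.  [tensor_rel] is the least congruence on the monoid of such
   lists which makes concatenation commutative and the pure tensor biadditive
   and A-balanced; inverses come for free, as (x, c) ++ (- x, c) ~ (0, c) ~ 0. *)
Inductive tensor_rel : seq (M * K) -> seq (M * K) -> Prop :=
| tensor_refl s : tensor_rel s s
| tensor_sym s t : tensor_rel s t -> tensor_rel t s
| tensor_trans s t u : tensor_rel s t -> tensor_rel t u -> tensor_rel s u
| tensor_cat s s' t t' :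
    tensor_rel s s' -> tensor_rel t t' -> tensor_rel (s ++ t) (s' ++ t')
| tensor_catC s t : tensor_rel (s ++ t) (t ++ s)
| tensor_zero c : tensor_rel [:: (0, c)] [::]
| tensor_addl x y c : tensor_rel [:: (x + y, c)] [:: (x, c); (y, c)]
| tensor_addr x c d : tensor_rel [:: (x, c + d)] [:: (x, c); (x, d)]
| tensor_balanced a x c : tensor_rel [:: (a *: x, c)] [:: (x, g a * c)].

Definition tensor_relb (s t : seq (M * K)) : bool := `[< tensor_rel s t >].

Fact tensor_relb_refl : reflexive tensor_relb.
Proof. by move=> s; apply/asboolP; exact: tensor_refl. Qed.
Fact tensor_relb_sym : symmetric tensor_relb.
Proof. by move=> s t; apply/asboolP/asboolP; exact: tensor_sym. Qed.
Fact tensor_relb_trans : transitive tensor_relb.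
Proof.
by move=> t s u /asboolP h1 /asboolP h2; apply/asboolP; exact: tensor_trans h2.
Qed.

Canonical tensor_equiv :=
  EquivRel tensor_relb tensor_relb_refl tensor_relb_sym tensor_relb_trans.

Definition ext_scalars := {eq_quot tensor_equiv}.
HB.instance Definition _ := Choice.on ext_scalars.
HB.instance Definition _ := EqQuotient.on ext_scalars.

Definition tensor_class (s : seq (M * K)) : ext_scalars := \pi_ext_scalars s.

Definition pure_tensor (x : M) (c : K) : ext_scalars := tensor_class [:: (x, c)].

Lemma tensor_classP s t : tensor_class s = tensor_class t <-> tensor_rel s t.
Proof.
split=> [/eqP|h]; last by apply/eqP; rewrite eqmodE; apply/asboolP.
by rewrite eqmodE => /asboolP.
Qed.

Lemma tensor_classK (u : ext_scalars) : tensor_class (repr u) = u.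
Proof. exact: reprK. Qed.

Definition tensor_add (u w : ext_scalars) : ext_scalars :=
  tensor_class (repr u ++ repr w).
Definition tensor_opp (u : ext_scalars) : ext_scalars :=
  tensor_class [seq (- p.1, p.2) | p <- repr u].
Definition tensor_scale (k : K) (u : ext_scalars) : ext_scalars :=
  tensor_class [seq (p.1, k * p.2) | p <- repr u].

Lemma tensor_class_add s t :
  tensor_add (tensor_class s) (tensor_class t) = tensor_class (s ++ t).
Proof.
by apply/tensor_classP/tensor_cat; apply/tensor_classP; rewrite tensor_classK.
Qed.

Lemma tensor_rel_opp s t : tensor_rel s t ->
  tensor_rel [seq (- p.1, p.2) | p <- s] [seq (- p.1, p.2) | p <- t].
Proof.
elim=> {s t} /=.
- by move=> s; exact: tensor_refl.
- by move=> s t _; exact: tensor_sym.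
- by move=> s t u _ h1 _; exact: tensor_trans.
- by move=> s s' t t' _ h1 _ h2; rewrite !map_cat; exact: tensor_cat.
- by move=> s t; rewrite !map_cat; exact: tensor_catC.
- by move=> c; rewrite oppr0; exact: tensor_zero.
- by move=> x y c; rewrite opprD; exact: tensor_addl.
- by move=> x c d; exact: tensor_addr.
- by move=> a x c; rewrite -scalerN; exact: tensor_balanced.
Qed.

Lemma tensor_rel_scale k s t : tensor_rel s t ->
  tensor_rel [seq (p.1, k * p.2) | p <- s] [seq (p.1, k * p.2) | p <- t].
Proof.
elim=> {s t} /=.
- by move=> s; exact: tensor_refl.
- by move=> s t _; exact: tensor_sym.
- by move=> s t u _ h1 _; exact: tensor_trans.
- by move=> s s' t t' _ h1 _ h2; rewrite !map_cat; exact: tensor_cat.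
- by move=> s t; rewrite !map_cat; exact: tensor_catC.
- by move=> c; exact: tensor_zero.
- by move=> x y c; exact: tensor_addl.
- by move=> x c d; rewrite mulrDr; exact: tensor_addr.
- by move=> a x c; rewrite mulrCA; exact: tensor_balanced.
Qed.

Lemma tensor_class_opp s :
  tensor_opp (tensor_class s) = tensor_class [seq (- p.1, p.2) | p <- s].
Proof.
apply/tensor_classP/tensor_rel_opp/tensor_classP; exact: tensor_classK.
Qed.

Lemma tensor_class_scale k s :
  tensor_scale k (tensor_class s) = tensor_class [seq (p.1, k * p.2) | p <- s].
Proof.
apply/tensor_classP/tensor_rel_scale/tensor_classP; exact: tensor_classK.
Qed.

Fact tensor_addA : associative tensor_add.
Proof.
move=> u w z; rewrite -[u]tensor_classK -[w]tensor_classK -[z]tensor_classK.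
by rewrite !tensor_class_add catA.
Qed.

Fact tensor_addC : commutative tensor_add.
Proof.
move=> u w; rewrite -[u]tensor_classK -[w]tensor_classK !tensor_class_add.
exact/tensor_classP/tensor_catC.
Qed.

Fact tensor_add0 : left_id (tensor_class [::]) tensor_add.
Proof. by move=> u; rewrite -[u]tensor_classK tensor_class_add. Qed.

Fact tensor_addN : left_inverse (tensor_class [::]) tensor_opp tensor_add.
Proof.
move=> u; rewrite -[u]tensor_classK tensor_class_opp tensor_class_add.
elim: (repr u) => [//|[x c] s IH] /=.
have -> : (- x, c) :: [seq (- p.1, p.2) | p <- s] ++ (x, c) :: s =
  [:: (- x, c)] ++ ([seq (- p.1, p.2) | p <- s] ++ [:: (x, c)]) ++ s.
  by rewrite -catA.
rewrite -!tensor_class_add.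
rewrite [tensor_add (tensor_class (map _ _)) _]tensor_addC -!tensor_addA.
rewrite [tensor_add (tensor_class (map _ _)) _]tensor_class_add IH.
rewrite !tensor_class_add /=; apply/tensor_classP.
apply: tensor_trans (tensor_zero c).
by rewrite -[0](addNr x); apply: tensor_sym; exact: tensor_addl.
Qed.

HB.instance Definition _ := GRing.isZmodule.Build ext_scalars
  tensor_addA tensor_addC tensor_add0 tensor_addN.

Fact tensor_scaleA a b u :
  tensor_scale a (tensor_scale b u) = tensor_scale (a * b) u.
Proof.
rewrite -[u]tensor_classK !tensor_class_scale -map_comp.
by congr tensor_class; apply: eq_map => p /=; rewrite mulrA.
Qed.

Fact tensor_scale1 : left_id 1 tensor_scale.
Proof.
move=> u; rewrite -[u]tensor_classK tensor_class_scale.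
by congr tensor_class; apply: map_id_in => -[x c] _ /=; rewrite mul1r.
Qed.

Fact tensor_scaleDr : right_distributive tensor_scale +%R.
Proof.
move=> k u w; rewrite -[u]tensor_classK -[w]tensor_classK.
rewrite [_ + _]tensor_class_add !tensor_class_scale map_cat.
by rewrite -tensor_class_add.
Qed.

Fact tensor_scaleDl u : {morph tensor_scale^~ u : a b / a + b}.
Proof.
move=> a b; rewrite -[u]tensor_classK !tensor_class_scale.
rewrite [RHS]tensor_class_add; elim: (repr u) => [//|[x c] s IH] /=.
rewrite mulrDl -[(x, a * c) :: _]cat1s -[(x, b * c) :: _]cat1s.
rewrite -[(x, a * c + b * c) :: _]cat1s -!tensor_class_add IH.
rewrite -!tensor_class_add.
have -> : tensor_class [:: (x, a * c + b * c)] =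
    tensor_add (tensor_class [:: (x, a * c)]) (tensor_class [:: (x, b * c)]).
  by rewrite tensor_class_add; apply/tensor_classP; exact: tensor_addr.
rewrite -!tensor_addA; congr tensor_add; rewrite tensor_addA.
by rewrite [tensor_add (tensor_class [:: _]) _]tensor_addC -tensor_addA.
Qed.

HB.instance Definition _ := GRing.Zmodule_isLmodule.Build K ext_scalars
  tensor_scaleA tensor_scale1 tensor_scaleDr tensor_scaleDl.

Lemma pure_tensorDl x y c :
  pure_tensor (x + y) c = pure_tensor x c + pure_tensor y c.
Proof. by rewrite [RHS]tensor_class_add; exact/tensor_classP/tensor_addl. Qed.

Lemma pure_tensorDr x c d :
  pure_tensor x (c + d) = pure_tensor x c + pure_tensor x d.
Proof. by rewrite [RHS]tensor_class_add; exact/tensor_classP/tensor_addr. Qed.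

Lemma pure_tensor_balanced a x c :
  pure_tensor (a *: x) c = pure_tensor x (g a * c).
Proof. exact/tensor_classP/tensor_balanced. Qed.

Lemma pure_tensorZ k x c : k *: pure_tensor x c = pure_tensor x (k * c).
Proof. exact: tensor_class_scale. Qed.

Lemma tensor_class_sum s :
  tensor_class s = \sum_(p <- s) pure_tensor p.1 p.2.
Proof.
elim: s => [|[x c] s IH]; first by rewrite big_nil.
by rewrite big_cons -IH [RHS]tensor_class_add.
Qed.

Lemma ext_scalars_universal (W : zmodType) (h : M -> K -> W) :
    (forall x y c, h (x + y) c = h x c + h y c) ->
    (forall x c d, h x (c + d) = h x c + h x d) ->
    (forall a x c, h (a *: x) c = h x (g a * c)) ->
  exists! H : ext_scalars -> W,
    {morph H : u w / u + w} /\ forall x c, H (pure_tensor x c) = h x c.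
Proof.
move=> hDl hDr hbal.
have h0 c : h 0 c = 0.
  by apply: (addrI (h 0 c)); rewrite -hDl !addr0.
pose S s := \sum_(p <- s) h p.1 p.2.
have SE s t : tensor_rel s t -> S s = S t.
  elim=> {s t}; rewrite /S //=.
  - by move=> s t u _ -> _ ->.
  - by move=> s s' t t' _ h1 _ h2; rewrite !big_cat /= h1 h2.
  - by move=> s t; rewrite !big_cat /= addrC.
  - by move=> c; rewrite big_seq1 big_nil /=.
  - by move=> x y c; rewrite !(big_cons, big_nil) /= !addr0.
  - by move=> x c d; rewrite !(big_cons, big_nil) /= !addr0.
  - by move=> a x c; rewrite !big_seq1 /=.
have SK s : S (repr (tensor_class s)) = S s.
  by apply/SE/tensor_classP; rewrite tensor_classK.
exists (fun u => S (repr u)); split; first split.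
- move=> u w; rewrite -{1}[u]tensor_classK -{1}[w]tensor_classK.
  by rewrite [_ + _]tensor_class_add SK /S big_cat.
- by move=> x c; rewrite SK /S big_seq1.
- move=> H [HD Hp]; apply/funext => u.
  have H0 : H 0 = 0 by apply: (addrI (H 0)); rewrite -HD !addr0.
  rewrite -[in RHS](tensor_classK u) tensor_class_sum.
  rewrite (big_morph H HD H0) /S.
  by apply: eq_bigr => p _; rewrite Hp.
Qed.

End ExtensionOfScalars.

Definition has_dimension (F : fieldType) (V : lmodType F) (n : nat) : Prop :=
  exists e : 'I_n -> V,
    forall x : V, exists! c : 'rV[F]_n, x = \sum_(i < n) c 0 i *: e i.

Definition finite_dimensional (F : fieldType) (V : lmodType F) : Prop :=
  exists n : nat, has_dimension V n.

Section Spectrum.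
Variable R : pzRingType.

Definition two_sided_ideal (I : set R) : Prop :=
  [/\ I 0, forall x y, I x -> I y -> I (x - y),
      forall r x, I x -> I (r * x) & forall r x, I x -> I (x * r)].

Definition ideal_mul (I J : set R) : set R :=
  [set x | exists s : seq (R * R),
     (forall p, p \in s -> I p.1 /\ J p.2) /\ x = \sum_(p <- s) p.1 * p.2].

Definition Spec : set (set R) :=
  [set P | [/\ two_sided_ideal P, P <> [set: R] &
     forall I J : set R, two_sided_ideal I -> two_sided_ideal J ->
       ideal_mul I J `<=` P -> I `<=` P \/ J `<=` P]].

End Spectrum.

(* An A-algebra is given by its structure morphism rather than as an [algType]
   over A, which would exclude the zero ring. *)
Section Algebras.
Variables (A : comPzRingType) (R : pzRingType) (phi : {rmorphism A -> R}).

Definition central_morphism : Prop := forall c r, phi c * r = r * phi c.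

Definition torsion_free : Prop :=
  forall c r, phi c * r = 0 -> c = 0 \/ r = 0.

Definition contraction (I : set R) : set A := [set c | I (phi c)].

Definition satisfies_INC : Prop :=
  forall Q1 Q2 : set R, Spec Q1 -> Spec Q2 ->
    Q1 `<` Q2 -> contraction Q1 `<` contraction Q2.

End Algebras.

(* Main.v *)
Require Import Defs.
From mathcomp Require Import all_boot all_order all_algebra.
From mathcomp Require Import boolp classical_sets.

Set Implicit Arguments.
Unset Strict Implicit.
Unset Printing Implicit Defensive.

Import Order.TTheory GRing.Theory Num.Theory.
Local Open Scope ring_scope.
Local Open Scope classical_set_scope.

(** Let Q1 be properly contained in Q2, both prime, and suppose that they have
    the same contraction p.  If n is the dimension of the extension of R to F,
    any n + 1 elements of R are linearly dependent over F; dividing the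
    coefficients by one of least value puts them in the valuation domain and
    makes one of them 1 ([finite_dimensional_bounded_rank]).  Such a relation
    remains nontrivial modulo p.  Hence, if K is the fraction field of the
    quotient of the valuation domain by p, the localization A of R / Q1 over K
    has dimension at most n.  It is a prime ring, and a prime finite-dimensional
    algebra is simple; the nonzero ideal of A coming from Q2 is therefore A
    itself, so that Q2 contains a scalar outside p, a contradiction.

    The algebra A is never constructed.  Its left ideals correspond to the
    [saturated_left_ideal]s of R, and the dependence relations bound the length
    of their chains ([no_long_chain]), which yields minimal ones.

    Simplicity of A ([ideal_meets_scalars]) is shown as follows.  Let I be a
    nonzero ideal of A and X minimal among the left ideals with I + X = A, so
    that 1 - u lies in X for some u in I.  If X is nonzero it contains a minimal
    left ideal M, and X m <> 0 for some m in M because A is prime.  Put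
    Y = X :&: Ann(m), a left ideal properly contained in X.  It still satisfies
    I + Y = A, against minimality of X:
    - if (I :&: X) m <> 0, then (I :&: X) m = M, so b m = (1 - u) m for some b
      in I :&: X, and 1 - (u + b) lies in Y;
    - if (I :&: X) m = 0, then I (1 - u) m = 0 since I (1 - u) is contained in
      I :&: X; as A is prime, (1 - u) m = 0 and 1 - u lies in Y.
    Hence X = 0 and 1 = u lies in I. *)

(** * Divisibility in a valuation domain *)

Section ValuationDomainTheory.
Variables (F : fieldType) (G : orderedZmodType) (v : valuation F G).
Local Notation O := (valuation_domain_pred v).

Lemma valuation_domain_total (x : F) : (x \in O) || (x^-1 \in O).
Proof.
have [->|x0] := eqVneq x 0; first by rewrite rpred0.
rewrite !unfold_in /valuation_domain_pred.
have : v (x * x^-1) = Some 0 by rewrite mulfV // val_one.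
rewrite val_mul; case: (v x) (v x^-1) => [a|] [b|] //= [ab0].
have /orP[->//|le] := ordered_le_total 0 a.
by apply/orP; right; have := ordered_leD2l b _ _ le; rewrite addr0 addrC ab0.
Qed.

Lemma exists_denominator (x : F) :
  exists2 d : F, d != 0 & (d \in O) && (d * x \in O).
Proof.
have [xO|xO] := boolP (x \in O).
  by exists 1; rewrite ?oner_neq0 // rpred1 mul1r.
have := valuation_domain_total x; rewrite (negPf xO) /= => xVO.
have x0 : x != 0 by apply: contraNneq xO => ->; rewrite rpred0.
by exists x^-1; rewrite ?invr_eq0 // xVO mulVf // rpred1.
Qed.

Lemma exists_common_denominator (s : seq F) :
  exists2 d : F, d != 0 & (d \in O) && all (fun x => d * x \in O) s.
Proof.
elim: s => [|x s [d d0 /andP[dO ds]]].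
  by exists 1; rewrite ?oner_neq0 // rpred1.
have [e e0 /andP[eO ex]] := exists_denominator x.
exists (d * e); rewrite ?mulf_neq0 // rpredM //= -mulrA rpredM //=.
by apply: sub_all ds => y dy; rewrite mulrAC mulrC rpredM.
Qed.

(** Divisibility by the valuation domain is a total preorder on F, so that a
    finite family has an entry m that divides all others. *)
Lemma exists_common_divisor (s : seq F) : has (fun x => x != 0) s ->
  exists m, [/\ m \in s, m != 0 & all (fun x => x / m \in O) s].
Proof.
elim: s => [//|x s IH] /=; have [hs _|hs] := boolP (has (fun x => x != 0) s).
  have [m [ms m0 ma]] := IH hs.
  have [xm|xm] := boolP (x / m \in O).
    by exists m; rewrite inE ms orbT m0 /= xm ma.
  have := valuation_domain_total (x / m); rewrite (negPf xm) /= invf_div => mx.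
  have x0 : x != 0 by apply: contraNneq xm => ->; rewrite mul0r rpred0.
  exists x; rewrite inE eqxx x0 /= divff // rpred1; split=> //=.
  apply: sub_all ma => y ym.
  have -> : y / x = (y / m) * (m / x) by rewrite mulrA divfK.
  by rewrite rpredM.
rewrite orbF => x0; exists x; rewrite inE eqxx x0 /= divff // rpred1.
split=> //=; apply/allP => y ys; move/hasPn/(_ y ys)/negPn/eqP: hs => ->.
by rewrite mul0r rpred0.
Qed.

End ValuationDomainTheory.

(** * Linear dependence in a torsion-free algebra *)

(** Requiring a coefficient equal to 1, and not merely a nonzero one, is what
    lets the relation survive reduction modulo any proper ideal of A. *)
Definition bounded_rank (A : comPzRingType) (R : pzRingType)
    (phi : {rmorphism A -> R}) (n : nat) : Prop :=
  forall r : 'I_n.+1 -> R, exists2 c : 'I_n.+1 -> A,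
    exists j, c j = 1 & \sum_i phi (c i) * r i = 0.

Section TorsionFreeAlgebra.
Variables (F : fieldType) (G : orderedZmodType) (v : valuation F G).
Variables (R : pzRingType) (phi : {rmorphism valuation_domain v -> R}).
Hypothesis htf : torsion_free phi.

Local Notation O := (valuation_domain_pred v).
Local Notation M := (restr_scalars phi).
Local Notation V := (ext_scalars (vd_incl v) M).

Definition integral_part (x : F) : valuation_domain v := insubd 0 x.

Lemma integral_partK (x : F) : x \in O -> val (integral_part x) = x.
Proof. by move=> xO; rewrite val_insubd xO. Qed.

Lemma integral_partD x y : x \in O -> y \in O ->
  integral_part (x + y) = integral_part x + integral_part y.
Proof.
by move=> xO yO; apply: val_inj; rewrite rmorphD /= !integral_partK ?rpredD.
Qed.

Lemma integral_partM x y : x \in O -> y \in O ->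
  integral_part (x * y) = integral_part x * integral_part y.
Proof.
by move=> xO yO; apply: val_inj; rewrite rmorphM /= !integral_partK ?rpredM.
Qed.

Lemma integral_part_val (a : valuation_domain v) : integral_part (val a) = a.
Proof. by apply: val_inj; rewrite integral_partK //; exact: (valP a). Qed.

Definition clears (d : F) (s : seq (M * F)) : bool :=
  all (fun p => d * p.2 \in O) s.

(** The element d * s of R, for a formal tensor s whose denominators all
    divide d. *)
Definition cleared_sum (d : F) (s : seq (M * F)) : R :=
  \sum_(p <- s) phi (integral_part (d * p.2)) * (p.1 : R).

Lemma cleared_sumM e d s : e \in O -> clears d s ->
  cleared_sum (e * d) s = phi (integral_part e) * cleared_sum d s.
Proof.
move=> eO /allP ds; rewrite /cleared_sum mulr_sumr big_seq [RHS]big_seq.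
apply: eq_bigr => p /ds dp.
by rewrite -mulrA integral_partM // rmorphM mulrA.
Qed.

(** Since R is torsion-free, multiplying by a common denominator d is well
    defined on tensors: this replaces the map from the tensor product to the
    localization of R, and gives the injectivity in [pure_tensor_eq0]. *)
Lemma cleared_sum_tensor_rel (s t : seq (M * F)) :
  tensor_rel (vd_incl v) s t ->
  forall d, clears d s -> clears d t -> cleared_sum d s = cleared_sum d t.
Proof.
elim=> {s t} //.
- by move=> s t _ IH d hs ht; rewrite IH.
- move=> s t u _ IH1 _ IH2 d hs hu.
  (* The list t of a transitivity step need not be cleared by d: enlarge d by
     a factor e that clears it, and cancel e at the end. *)
  have [e e0 /andP[eO et]] :=
    exists_common_denominator v [seq d * p.2 | p <- t].
  have clearsM w : clears d w -> clears (e * d) w.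
    by apply: sub_all => p dp; rewrite -mulrA rpredM.
  have ht : clears (e * d) t.
    by move: et; rewrite all_map; apply: sub_all => p /=; rewrite mulrA.
  have E : cleared_sum (e * d) s = cleared_sum (e * d) u.
    by rewrite IH1 ?IH2 // clearsM.
  have : phi (integral_part e) * (cleared_sum d s - cleared_sum d u) = 0.
    by rewrite mulrBr -!cleared_sumM // E subrr.
  case/htf => [ie|/eqP]; last by rewrite subr_eq0 => /eqP.
  by case/eqP: e0; rewrite -(integral_partK eO) ie.
- move=> s s' t t' _ IH1 _ IH2 d; rewrite /clears !all_cat.
  move=> /andP[h1 h2] /andP[h3 h4].
  by rewrite /cleared_sum !big_cat /=; congr (_ + _); [exact: IH1|exact: IH2].
- by move=> s t d _ _; rewrite /cleared_sum !big_cat /= addrC.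
- by move=> c d _ _; rewrite /cleared_sum big_seq1 big_nil mulr0.
- by move=> x y c d _ _; rewrite /cleared_sum !big_cons !big_nil !addr0 mulrDr.
- move=> x c c' d _ /=; rewrite /clears /= => /and3P[h1 h2 _].
  rewrite /cleared_sum !big_cons !big_nil /= !addr0 mulrDr.
  by rewrite integral_partD // rmorphD mulrDl.
- move=> a x c d /=; rewrite /clears /= !andbT => h1 _.
  rewrite /cleared_sum !big_seq1 /=.
  have -> : d * (vd_incl v a * c) = (d * c) * val a by rewrite mulrCA mulrC.
  rewrite (integral_partM h1 (valP a)) integral_part_val rmorphM.
  by rewrite -mulrA.
Qed.

Lemma pure_tensor_eq0 (y : M) : pure_tensor (vd_incl v) y 1 = 0 -> y = 0.
Proof.
move/tensor_classP/cleared_sum_tensor_rel/(_ 1).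
rewrite /clears /cleared_sum /= big_seq1 big_nil mulr1 rpred1 => /(_ isT isT).
have -> : integral_part 1 = 1.
  by apply: val_inj; rewrite integral_partK ?rpred1.
by rewrite rmorph1 mul1r.
Qed.

Lemma pure_tensor0 c : pure_tensor (vd_incl v) (0 : M) c = 0.
Proof. exact/tensor_classP/tensor_zero. Qed.

Lemma exists_linear_relation n (x : 'I_n.+1 -> V) : has_dimension V n ->
  exists2 k : 'rV[F]_n.+1, k != 0 & \sum_i k 0 i *: x i = 0.
Proof.
case=> e he; have /choice [c hc] (i : 'I_n.+1) :
    exists c : 'rV[F]_n, x i = \sum_(j < n) c 0 j *: e j.
  by case: (he (x i)) => c [hc _]; exists c.
pose C := \matrix_(i, j) c i 0 j.
have : kermx C != 0.
  rewrite -mxrank_eq0 mxrank_ker subn_eq0 -ltnNge ltnS; exact: rank_leq_col.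
case/rowV0Pn => k /sub_kermxP kC k0; exists k => //.
under eq_bigr => i _ do rewrite hc scaler_sumr.
rewrite exchange_big /= big1 // => j _.
under eq_bigr => i _ do rewrite scalerA.
have /matrixP/(_ 0 j) := kC; rewrite !mxE => kCj.
have {}kCj : \sum_i k 0 i * c i 0 j = 0.
  by rewrite -[RHS]kCj; apply: eq_bigr => i _; rewrite mxE.
by rewrite -scaler_suml kCj scale0r.
Qed.

Lemma finite_dimensional_bounded_rank n :
  has_dimension V n -> bounded_rank phi n.
Proof.
move=> hn r.
have [k k0 kr] := exists_linear_relation
  (fun i => pure_tensor (vd_incl v) (r i : M) 1) hn.
have : has (fun x => x != 0) [seq k 0 i | i <- enum 'I_n.+1].
  apply: contraNT k0 => /hasPn h; apply/eqP/rowP => i; rewrite mxE.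
  by apply/eqP/negPn/h/map_f; rewrite mem_enum.
case/(exists_common_divisor v) => m [/mapP[j _ mE] m0 /allP hm].
have kO i : k 0 i / m \in O by apply/hm/map_f; rewrite mem_enum.
exists (fun i => integral_part (k 0 i / m)).
  by exists j; apply: val_inj; rewrite integral_partK // -mE divff.
apply: pure_tensor_eq0.
rewrite (big_morph (fun x : M => pure_tensor (vd_incl v) x 1)
  (id1 := 0) (op1 := +%R)); first last.
- exact: pure_tensor0.
- by move=> x y; exact: pure_tensorDl.
rewrite -[RHS](scaler0 _ m^-1) -[in RHS]kr scaler_sumr; apply: eq_bigr => i _.
rewrite (pure_tensor_balanced (vd_incl v) (integral_part (k 0 i / m))
  (r i : M)).
rewrite !pure_tensorZ !mulr1 [m^-1 * _]mulrC.
by congr pure_tensor; exact: (integral_partK (kO i)).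
Qed.

End TorsionFreeAlgebra.

(** * Prime ideals and saturated left ideals *)

Section PrimeIdeals.
Variable R : pzRingType.

(** Instead of the ideals generated by a and b, the proof uses the transporters
    I = {x | x R b in Q} and J = {y | I R y in Q}, which contain them and avoid
    sums of products. *)
Lemma Spec_prime (Q : set R) (a b : R) : Spec Q ->
  (forall r, Q (a * r * b)) -> Q a \/ Q b.
Proof.
case=> [[Q0 QB QL QR] _ Qp] hab.
pose I := [set x | forall r, Q (x * r * b)].
pose J := [set y | forall x, I x -> forall r, Q (x * r * y)].
have tI : two_sided_ideal I.
  split=> [r|x y hx hy r|t x hx r|t x hx r].
  - by rewrite !mul0r.
  - by rewrite !mulrBl; exact: QB.
  - by rewrite -2!mulrA; apply: QL; rewrite mulrA; exact: hx.
  - by rewrite -(mulrA x); exact: hx.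
have tJ : two_sided_ideal J.
  split=> [x _ r|y z hy hz x hx r|t y hy x hx r|t y hy x hx r].
  - by rewrite mulr0.
  - by rewrite mulrBr; apply: QB; [exact: hy|exact: hz].
  - by rewrite mulrA -(mulrA x); exact: hy.
  - by rewrite mulrA; apply/QR/hy.
have IJ : ideal_mul I J `<=` Q.
  move=> x [s [hs ->]]; elim: s hs => [|p s IH] hs; first by rewrite big_nil.
  have QD u w : Q u -> Q w -> Q (u + w).
    by move=> Qu Qw; rewrite -[w]opprK; apply: (QB) => //;
       rewrite -sub0r; exact: QB.
  rewrite big_cons; apply: QD.
    have [Ip Jp] := hs p (mem_head _ _).
    by rewrite -[p.1]mulr1; exact: Jp.
  by apply: IH => q qs; apply: hs; rewrite inE qs orbT.
case: (Qp I J tI tJ IJ) => h; [left|right]; apply: h => // x hx r; exact: hx.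
Qed.

End PrimeIdeals.

Section Saturation.
Variables (A : comPzRingType) (R : pzRingType) (phi : {rmorphism A -> R}).
Hypothesis hcentral : central_morphism phi.
Variables (n : nat) (hrank : bounded_rank phi n).
Variables (Q : set R) (hQ : Spec Q).

(** These sets are the preimages in R of the left ideals of the localization of
    R / Q at the nonzero scalars of the quotient of A by the contraction of Q. *)
Record saturated_left_ideal (X : set R) : Prop := SaturatedLeftIdeal {
  saturated_sup : Q `<=` X;
  saturatedB : forall x y, X x -> X y -> X (x - y);
  saturatedM : forall r x, X x -> X (r * x);
  saturated_cancel : forall c r, ~ Q (phi c) -> X (phi c * r) -> X r
}.

Let Q0 : Q 0. Proof. by case: hQ => -[]. Qed.
Let QB x y : Q x -> Q y -> Q (x - y).
Proof. by case: hQ => -[_ h _ _] _ _; exact: h. Qed.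
Let QL r x : Q x -> Q (r * x).
Proof. by case: hQ => -[_ _ h _] _ _; exact: h. Qed.
Let QR r x : Q x -> Q (x * r).
Proof. by case: hQ => -[_ _ _ h] _ _; exact: h. Qed.

Lemma Spec_cancel c r : ~ Q (phi c) -> Q (phi c * r) -> Q r.
Proof.
move=> hc hr; have [t||//] := @Spec_prime _ _ (phi c) r hQ.
  by rewrite hcentral -mulrA; exact: QL.
by [].
Qed.

Lemma contraction_prime c d : ~ Q (phi c) -> ~ Q (phi d) -> ~ Q (phi (c * d)).
Proof. by move=> hc hd; rewrite rmorphM => /(Spec_cancel hc). Qed.

Lemma contraction_proper : ~ Q (phi 1).
Proof.
case: hQ => _ QT _ h; apply: QT; apply/seteqP; split=> // x _.
by rewrite -[x]mulr1 -(rmorph1 phi); exact: QL.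
Qed.

Lemma saturated0 X : saturated_left_ideal X -> X 0.
Proof. by move=> hX; exact: (saturated_sup hX). Qed.

Lemma saturatedD X x y : saturated_left_ideal X -> X x -> X y -> X (x + y).
Proof.
move=> hX Xx Xy; rewrite -[y]opprK; apply: (saturatedB hX) => //.
by rewrite -sub0r; apply: (saturatedB hX) => //; exact: saturated0.
Qed.

Lemma saturated_sum X (I : finType) (P : pred I) (f : I -> R) :
  saturated_left_ideal X -> (forall i, P i -> X (f i)) ->
  X (\sum_(i | P i) f i).
Proof.
move=> hX hf; elim/big_ind: _ => //; first exact: saturated0.
by move=> x y; exact: saturatedD.
Qed.

(** Choose r_i in X_i outside X_(i+1) and apply the rank bound to r_0, ..., r_n.
    If i is the first index whose coefficient is nonzero modulo Q, every other
    term of the relation lies in X_(i+1), and saturation puts r_i there too. *)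
Lemma no_long_chain (X : nat -> set R) :
  (forall i, saturated_left_ideal (X i)) ->
  (forall i, X i.+1 `<` X i) -> False.
Proof.
move=> hX hlt.
have /choice[r hr] i : exists x, X i x /\ ~ X i.+1 x.
  by have [_ /nonsubset[x hx]] := hlt i; exists x.
have decr i j : (i <= j)%N -> X j `<=` X i.
  elim: j => [|j IH]; first by rewrite leqn0 => /eqP ->.
  rewrite leq_eqVlt => /orP[/eqP -> //|ij].
  by apply: subset_trans (IH ij); case: (hlt j).
have [c [j cj] hc] := hrank (fun i => r i).
pose P (i : 'I_n.+1) : bool := ~~ `[< Q (phi (c i)) >].
have Pj : P j by apply/negP => /asboolP; rewrite cj; exact: contraction_proper.
case: (arg_minnP (fun i : 'I_n.+1 => nat_of_ord i) Pj) => i Pi imin.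
have [_] := hr i; apply; apply: (saturated_cancel (hX i.+1) (c := c i)).
  by move=> Qi; move/negP: Pi; apply; apply/asboolP.
move: hc; rewrite (bigD1 i) //= => /eqP; rewrite addr_eq0 => /eqP ->.
rewrite -sub0r; apply: (saturatedB (hX _)); first exact: saturated0.
apply: saturated_sum => // k ki; have [ik|ki'] := ltnP i k.
  by apply: (saturatedM (hX _)); apply: (decr _ _ ik); case: (hr k).
have kli : (k < i)%N by rewrite ltn_neqAle ki' andbT.
apply: (saturated_sup (hX _)); apply: QR.
have [//|nQ] := pselect (Q (phi (c k))).
have : P k by apply/negP => /asboolP.
by move/imin; rewrite leqNgt kli.
Qed.

Lemma exists_minimal_saturated (E : set R -> Prop) (X0 : set R) :
  (forall X, E X -> saturated_left_ideal X) -> E X0 ->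
  exists2 X, E X & forall Y, E Y -> Y `<=` X -> X `<=` Y.
Proof.
move=> hE EX0; apply: contrapT => nmin.
have /choice[f hf] (X : {X | E X}) : exists Y : {X | E X}, sval Y `<` sval X.
  apply: contrapT => nY; apply: nmin; exists (sval X); first exact: svalP.
  move=> Y EY YX; apply: contrapT => nXY; apply: nY; by exists (exist _ Y EY).
pose X i := sval (iter i f (exist _ X0 EX0)).
by apply: (@no_long_chain X) => i; [apply/hE/svalP | exact: hf].
Qed.

Lemma saturated_setI X Y : saturated_left_ideal X -> saturated_left_ideal Y ->
  saturated_left_ideal (X `&` Y).
Proof.
move=> hX hY; split.
- by move=> x Qx; split; [exact: (saturated_sup hX)|exact: (saturated_sup hY)].
- by move=> x y [? ?] [? ?]; split;
    [exact: (saturatedB hX)|exact: (saturatedB hY)].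
- by move=> r x [? ?]; split; [exact: (saturatedM hX)|exact: (saturatedM hY)].
- move=> c r hc [? ?]; split;
    [exact: (saturated_cancel hX hc)|exact: (saturated_cancel hY hc)].
Qed.

Lemma saturated_ann (m : R) : saturated_left_ideal [set x | Q (x * m)].
Proof.
split=> /=.
- by move=> x Qx; exact: QR.
- by move=> x y hx hy; rewrite mulrBl; exact: QB.
- by move=> r x hx; rewrite -mulrA; exact: QL.
- by move=> c r hc; rewrite -mulrA; exact: Spec_cancel.
Qed.

(** For a left ideal B of R, the preimage in R of the left ideal that B m
    generates in the localization. *)
Definition mul_saturation (B : set R) (m : R) : set R :=
  [set x | exists t b, [/\ ~ Q (phi t), B b & Q (phi t * x - b * m)]].

Lemma saturated_mul_saturation (B : set R) (m : R) : B 0 ->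
  (forall x y, B x -> B y -> B (x - y)) -> (forall r x, B x -> B (r * x)) ->
  saturated_left_ideal (mul_saturation B m).
Proof.
move=> B0 BB BM; split=> /=.
- move=> x Qx; exists 1, 0; split=> //; first exact: contraction_proper.
  by rewrite mul0r subr0; exact: QL.
- move=> x y [t [b [ht hb hx]]] [u [d [hu hd hy]]].
  exists (t * u), (phi u * b - phi t * d); split.
  + exact: contraction_prime.
  + by apply: BB; exact: BM.
  + have -> : phi (t * u) * (x - y) - (phi u * b - phi t * d) * m =
      phi u * (phi t * x - b * m) - phi t * (phi u * y - d * m).
      rewrite !mulrBr mulrBl !mulrA -!rmorphM (mulrC u t) !opprB.
      rewrite -!addrA; congr (_ + _); rewrite addrCA [RHS]addrCA.
      by congr (_ + _); exact: addrC.
    by apply: QB; exact: QL.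
- move=> r x [t [b [ht hb hx]]]; exists t, (r * b); split=> //; first exact: BM.
  have -> : phi t * (r * x) - r * b * m = r * (phi t * x - b * m).
    by rewrite mulrBr mulrA hcentral !mulrA.
  exact: QL.
- move=> c r hc [t [b [ht hb hx]]]; exists (t * c), b; split=> //.
    exact: contraction_prime.
  by rewrite rmorphM -mulrA.
Qed.

Lemma exists_minimal_left_ideal (X : set R) :
  saturated_left_ideal X -> ~ X `<=` Q ->
  exists M, [/\ saturated_left_ideal M, ~ M `<=` Q &
    forall Y, saturated_left_ideal Y -> ~ Y `<=` Q -> Y `<=` M -> M `<=` Y].
Proof.
move=> hX nX.
pose E Y := saturated_left_ideal Y /\ ~ Y `<=` Q.
have [|M [hM nM] mM] := @exists_minimal_saturated E X _ (conj hX nX).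
  by move=> Y [].
by exists M; split=> // Y hY nY; exact: mM.
Qed.

(** * Simplicity of the localization *)

(** The elements u and b of the argument given at the top become u / s and
    b / (t * s), with scalars s and t outside Q. *)
Lemma ideal_meets_scalars (I : set R) : two_sided_ideal I -> ~ I `<=` Q ->
  exists2 s, ~ Q (phi s) & exists2 u, I u & Q (phi s - u).
Proof.
case=> I0 IB IL IR nI.
have [i0 Ii0 nQi0] : exists2 x, I x & ~ Q x.
  by have /nonsubset[x [? ?]] := nI; exists x.
pose E (X : set R) := saturated_left_ideal X /\
  exists s u, [/\ ~ Q (phi s), I u & X (phi s - u)].
have ET : E [set: R].
  split; first by split.
  by exists 1, 0; split=> //; exact: contraction_proper.
have [X [hX [s [u [hs Iu Xsu]]]] minX] :
    exists2 X, E X & forall Y, E Y -> Y `<=` X -> X `<=` Y.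
  by apply: exists_minimal_saturated ET => Y [].
have [XQ|nXQ] := pselect (X `<=` Q).
  by exists s => //; exists u => //; exact: XQ.
exfalso.
have [M [hM nM minM]] := exists_minimal_left_ideal hX nXQ.
have [x0 Xx0 nx0] : exists2 x, X x & ~ Q x.
  by have /nonsubset[x [? ?]] := nXQ; exists x.
have [m0 Mm0 nm0] : exists2 x, M x & ~ Q x.
  by have /nonsubset[x [? ?]] := nM; exists x.
have [r0 hr0] : exists r, ~ Q (x0 * r * m0).
  apply: contrapT => /forallNP h.
  have [t|//|//] := @Spec_prime _ _ x0 m0 hQ.
  by apply: contrapT; exact: h.
pose m := r0 * m0.
have Mm : M m by exact: (saturatedM hM).
pose Y := X `&` [set x | Q (x * m)].
have hY : saturated_left_ideal Y.
  by apply: saturated_setI => //; exact: saturated_ann.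
suff EY : E Y.
  have XY : X `<=` Y by apply: minX => // x [].
  by apply: hr0; rewrite -mulrA; case: (XY _ Xx0).
split=> //.
pose B := I `&` X.
have B0 : B 0 by split=> //; exact: saturated0.
have BB x y : B x -> B y -> B (x - y).
  by move=> [? ?] [? ?]; split; [exact: IB|exact: (saturatedB hX)].
have BM r x : B x -> B (r * x).
  by move=> [? ?]; split; [exact: IL|exact: (saturatedM hX)].
have [Bm|nBm] := pselect (forall b, B b -> Q (b * m)).
  exists s, u; split=> //; split=> //=.
  have [r|//|//] := @Spec_prime _ _ i0 ((phi s - u) * m) hQ.
  rewrite mulrA; apply: Bm; split; first exact/IR/IR.
  exact: (saturatedM hX).
have [b0 Bb0 nb0] : exists2 b, B b & ~ Q (b * m).
  by move: nBm => /existsNP[x /not_implyP[? ?]]; exists x.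
have hO := saturated_mul_saturation m B0 BB BM.
(* By minimality of M, the nonzero left ideal generated by B m is M itself. *)
have MO : M `<=` mul_saturation B m.
  apply: minM => //.
    move=> /(_ (b0 * m)) h; apply/nb0/h; exists 1, b0; split=> //.
      exact: contraction_proper.
    by rewrite rmorph1 mul1r subrr.
  move=> x [t [b [ht Bb Qx]]]; apply: (saturated_cancel hM ht).
  rewrite -(subrK (b * m) (phi t * x)); apply: saturatedD => //.
    exact: (saturated_sup hM).
  exact: (saturatedM hM).
have [t [b [ht [Ib Xb] Qb]]] := MO _ (saturatedM hM (phi s - u) Mm).
have E1 : phi (t * s) - (phi t * u + b) = phi t * (phi s - u) - b.
  by rewrite mulrBr rmorphM opprD addrA.
exists (t * s), (phi t * u + b); split.
- exact: contraction_prime.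
- rewrite -[b]opprK; apply: (IB); first exact: IL.
  by rewrite -sub0r; exact: IB.
- rewrite E1; split; last by rewrite /= mulrBl -mulrA.
  by apply: (saturatedB hX) => //; exact: (saturatedM hX).
Qed.

End Saturation.

Lemma bounded_rank_INC (A : comPzRingType) (R : pzRingType)
    (phi : {rmorphism A -> R}) (n : nat) :
  central_morphism phi -> bounded_rank phi n -> satisfies_INC phi.
Proof.
move=> hcentral hrank Q1 Q2 hQ1 hQ2 [Q12 nQ21].
split=> [c Qc|h]; first exact: (Q12 _ Qc).
have tQ2 : two_sided_ideal Q2 by case: hQ2.
have [s hs [u Q2u Q1su]] := ideal_meets_scalars hcentral hrank hQ1 tQ2 nQ21.
case: tQ2 => Q0 QB _ _; apply/hs/h; rewrite /contraction /=.
have -> : phi s = (phi s - u) - (0 - u) by rewrite sub0r opprK subrK.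
by apply: (QB); [exact: (Q12 _ Q1su)|exact: QB].
Qed.

Theorem theorem2p6 (F : fieldType) (G : orderedZmodType) (v : valuation F G)
    (hv : nontrivial_valuation v)
    (R : pzRingType) (phi : {rmorphism valuation_domain v -> R})
    (hcentral : central_morphism phi)
    (htf : torsion_free phi)
    (hfin : finite_dimensional (ext_scalars (vd_incl v) (restr_scalars phi))) :
  satisfies_INC phi.
Proof.
have [n hn] := hfin.
exact: bounded_rank_INC hcentral (finite_dimensional_bounded_rank htf hn).
Qed.
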